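(* Let $\mathbb{K}$ be a field, let $A$ be a Poisson $\mathbb{K}$-algebra and let $A[X;\alpha,\delta]_P$ be a Poisson-Ore extension. Suppose that $\delta$ extends to an iterative, locally nilpotent higher $(\eta,\alpha)$-skew Poisson derivation $(D_i)$ on $A$ with $\eta\in\mathbb{K}^{\times}$. Then the algebra homomorphism $F:A\to A[X^{\pm1}]$ defined by $$F(a)=\sum_{i\ge0}\frac{1}{\eta^i}D_i(a)X^{-i}$$ uniquely extends to a Poisson $\mathbb{K}$-algebra isomorphism $$F:A[Y^{\pm1};\alpha]_P\xrightarrow{\ \cong\ }A[X^{\pm1};\alpha,\delta]_P$$ by setting $F(Y)=X$.
   Context: A Poisson $\mathbb{K}$-algebra is a commutative $\mathbb{K}$-algebra with a skew-symmetric $\mathbb{K}$-bilinear bracket satisfying the Jacobi identity and the Leibniz rule. A Poisson derivation of $A$ is a $\mathbb{K}$-derivation $\alpha$ with $\alpha(\{a,b\})=\{\alpha(a),b\}+\{a,\alpha(b)\}$. A Poisson $\alpha$-derivation is a $\mathbb{K}$-derivation $\delta$ with $\delta(\{a,b\})=\{\delta(a),b\}+\{a,\delta(b)\}+\alpha(a)\delta(b)-\delta(a)\alpha(b)$. Given such $\alpha,\delta$, the Poisson-Ore extension $A[X;\alpha,\delta]_P$ is the polynomial algebra $A[X]$ with the unique Poisson bracket extending that of $A$ with $\{X,a\}=\alpha(a)X+\delta(a)$. The Poisson-Ore Laurent algebra $A[X^{\pm1};\alpha,\delta]_P$ is its localisation at the powers of $X$, with the uniquely extended bracket. $A[Y;\alpha]_P$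 means $A[Y;\alpha,0]_P$, and similarly $A[Y^{\pm1};\alpha]_P$. A higher derivation on $A$ is a sequence $(D_i)_{i\ge0}$ of $\mathbb{K}$-linear maps $A\to A$ with $D_0=\mathrm{id}_A$ and $D_n(ab)=\sum_{i=0}^nD_i(a)D_{n-i}(b)$. It is iterative if $D_iD_j=\binom{i+j}{i}D_{i+j}$ for all $i,j$, and locally nilpotent if for each $a\in A$ there is $n\ge0$ with $D_i(a)=0$ for all $i\ge n$. It is a higher $(\eta,\alpha)$-skew Poisson derivation if moreover for all $a,b\in A$, $n\ge0$, $$D_n(\{a,b\})=\sum_{i=0}^n\Big(\{D_i(a),D_{n-i}(b)\}+i\big(\alpha D_{n-i}(a)D_i(b)-D_i(a)\,\alpha D_{n-i}(b)\big)\Big)$$ and $D_i\alpha=\alpha D_i+i\eta D_i$ for all $i\ge0$. ''$\delta$ extends to $(D_i)$'' means $D_1=\delta$. *)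

(* Defs.v *)
From HB Require Import structures.
From mathcomp Require Import all_boot all_algebra.
From mathcomp Require Import ring.
From mathcomp Require Import boolp classical_sets fsbigop.

Set Implicit Arguments.
Unset Strict Implicit.
Unset Printing Implicit Defensive.

Import GRing.Theory.
Local Open Scope ring_scope.
Local Open Scope quotient_scope.

(* Skew-symmetry is taken literally, so {a, a} = 0 is not required in
   characteristic 2. *)
HB.mixin Record isPoisson (K : fieldType) A of GRing.ComAlgebra K A := {
  pbr : A -> A -> A;
  pbr_linearl : forall (k : K) (a b c : A),
    pbr (k *: a + b) c = k *: pbr a c + pbr b c;
  pbrC : forall a b : A, pbr a b = - pbr b a;
  pbrMr : forall a b c : A, pbr a (b * c) = pbr a b * c + b * pbr a c;
  pbr_jacobi : forall a b c : A,
    pbr a (pbr b c) + pbr b (pbr c a) + pbr c (pbr a b) = 0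
}.

#[short(type="poissonAlgType")]
HB.structure Definition PoissonAlgebra (K : fieldType) :=
  {A of GRing.ComAlgebra K A & isPoisson K A}.

Reserved Notation "{[ a , b ]}" (at level 0, a, b at level 99,
  format "{[ a ,  b ]}").
Notation "{[ a , b ]}" := (pbr a b) : ring_scope.

Section PoissonTheory.
Variables (K : fieldType) (A : poissonAlgType K).
Implicit Types (a b c : A) (k : K).

Lemma pbr_linearr k a b c : {[c, k *: a + b]} = k *: {[c, a]} + {[c, b]}.
Proof. by rewrite pbrC pbr_linearl opprD -scalerN -!pbrC. Qed.

Lemma pbr_is_linear c : linear (pbr c).
Proof. by move=> k a b; rewrite pbr_linearr. Qed.

HB.instance Definition _ c :=
  GRing.isLinear.Build K A A *:%R (pbr c) (pbr_is_linear c).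

Lemma pbrDr c : {morph pbr c : a b / a + b}.
Proof. exact: raddfD. Qed.

Lemma pbrDl c : {morph pbr^~ c : a b / a + b}.
Proof. by move=> a b; rewrite pbrC pbrDr opprD -!pbrC. Qed.

Lemma pbr0r a : {[a, 0]} = 0. Proof. exact: raddf0. Qed.
Lemma pbr0l a : {[0, a]} = 0. Proof. by rewrite pbrC pbr0r oppr0. Qed.
Lemma pbrNr a b : {[a, - b]} = - {[a, b]}. Proof. exact: raddfN. Qed.
Lemma pbrNl a b : {[- a, b]} = - {[a, b]}.
Proof. by rewrite pbrC pbrNr -pbrC. Qed.
Lemma pbrZr k a b : {[a, k *: b]} = k *: {[a, b]}. Proof. exact: linearZ. Qed.
Lemma pbrZl k a b : {[k *: a, b]} = k *: {[a, b]}.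
Proof. by rewrite pbrC pbrZr -scalerN -pbrC. Qed.
Lemma pbrMl a b c : {[a * b, c]} = {[a, c]} * b + a * {[b, c]}.
Proof. by rewrite pbrC pbrMr opprD -mulNr -mulrN -!pbrC. Qed.

End PoissonTheory.

Section Derivations.
Variables (K : fieldType) (A : poissonAlgType K).

Definition derivation (d : {linear A -> A}) : Prop :=
  forall a b : A, d (a * b) = d a * b + a * d b.

Lemma derivation1 d : derivation d -> d 1 = 0.
Proof.
by move=> dM; apply: (addrI (d 1)); rewrite -[1 in RHS]mulr1 dM mulr1 mul1r addr0.
Qed.

Definition poisson_derivation (alpha : {linear A -> A}) : Prop :=
  derivation alpha /\
  forall a b : A, alpha {[a, b]} = {[alpha a, b]} + {[a, alpha b]}.

Definition poisson_skew_derivation (alpha delta : {linear A -> A}) : Prop :=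
  derivation delta /\
  forall a b : A, delta {[a, b]} =
    {[delta a, b]} + {[a, delta b]} + alpha a * delta b - delta a * alpha b.

Lemma poisson_skew_derivation0 (alpha : {linear A -> A}) :
  poisson_skew_derivation alpha \0.
Proof.
by split=> a b /=; rewrite ?pbr0l ?pbr0r ?(mulr0, mul0r, addr0, subr0).
Qed.

Definition higher_derivation (D : nat -> {linear A -> A}) : Prop :=
  D 0 =1 id /\
  forall n (a b : A), D n (a * b) = \sum_(i < n.+1) D i a * D (n - i)%N b.

Definition iterative (D : nat -> {linear A -> A}) : Prop :=
  forall i j (a : A), D i (D j a) = D (i + j)%N a *+ 'C(i + j, i).

Definition locally_nilpotent (D : nat -> {linear A -> A}) : Prop :=
  forall a : A, exists n, forall i, (n <= i)%N -> D i a = 0.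

Definition higher_skew_poisson_derivation
    (eta : K) (alpha : {linear A -> A}) (D : nat -> {linear A -> A}) : Prop :=
  [/\ higher_derivation D,
      forall n (a b : A), D n {[a, b]} =
        \sum_(i < n.+1)
          ({[D i a, D (n - i)%N b]}
           + (alpha (D (n - i)%N a) * D i b - D i a * alpha (D (n - i)%N b))
             *+ i)
    & forall i (a : A), D i (alpha a) = alpha (D i a) + (eta *: D i a) *+ i].

End Derivations.

Section Morphisms.
Variables (K : fieldType).

Definition algebra_morphism (A B : comAlgType K) (f : A -> B) : Prop :=
  linear f /\ monoid_morphism f.

Definition poisson_morphism (A B : poissonAlgType K) (f : A -> B) : Prop :=
  algebra_morphism f /\ forall a b : A, f {[a, b]} = {[f a, f b]}.

Definition poisson_isomorphism (A B : poissonAlgType K) (f : A -> B) : Prop :=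
  poisson_morphism f /\ bijective f.

End Morphisms.

Section Jacobiator.
Variables (R : comNzRingType) (br : R -> R -> R).
Hypothesis brDr : forall c, {morph br c : a b / a + b}.
Hypothesis brC : forall a b, br a b = - br b a.
Hypothesis brMr : forall a b c, br a (b * c) = br a b * c + b * br a c.

Let jac a b c := br a (br b c) + br b (br c a) + br c (br a b).

Let brNr a b : br a (- b) = - br a b.
Proof.
have br0 : br a 0 = 0 by apply: (addrI (br a 0)); rewrite -brDr !addr0.
by apply: (addrI (br a b)); rewrite -brDr !subrr.
Qed.

Let brDl c : {morph br^~ c : a b / a + b}.
Proof. by move=> a b; rewrite /= brC brDr opprD -!brC. Qed.

Lemma jacD a b : {morph jac a b : c d / c + d}.
Proof. by move=> c d; rewrite /jac !(brDr, brDl); ring. Qed.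

Lemma jacM a b c d : jac a b (c * d) = jac a b c * d + c * jac a b d.
Proof.
rewrite /jac ![br (c * d) _]brC ![br c _]brC ![br d _]brC !brNr.
by rewrite !(brMr, brDr); ring.
Qed.

Lemma jac_cycle a b c : jac a b c = jac b c a.
Proof. by rewrite /jac; ring. Qed.

End Jacobiator.

(* The Poisson-Ore extension A[X; alpha, delta]_P.  The only bracket on {poly A}
   that is a biderivation, extends the one of A, and satisfies
   {X, a} = alpha(a) X + delta(a) and {X, X} = 0 is
     {p, q} = sum_(i, j) {p_i, q_j} X^(i + j) + p' * theta(q) - theta(p) * q'
   where theta(q) = {X, q} is computed coefficientwise.  See ore_pbrC, ore_pbrX,
   ore_pbrXX and ore_pbr_unique below; {X, X} = 0 is automatic when 2 != 0 in
   K, and in characteristic 2 it is what alternation requires. *)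
Section OreBracket.
Variables (K : fieldType) (A : poissonAlgType K) (alpha delta : {linear A -> A}).
Implicit Types (p q r : {poly A}).

Definition ore_ad q : {poly A} := 'X * map_poly alpha q + map_poly delta q.

Definition coef_br p q : {poly A} :=
  \sum_(i < size p) \sum_(j < size q) {[p`_i, q`_j]} *: 'X^(i + j).

Definition ore_br p q : {poly A} :=
  coef_br p q + p^`() * ore_ad q - ore_ad p * q^`().

Lemma coef_brE p q n : (size p <= n)%N ->
  coef_br p q = \sum_(i < n) map_poly (pbr p`_i) q * 'X^i.
Proof.
move=> le_pn; rewrite /coef_br.
rewrite (big_ord_widen _
  (fun i => \sum_(j < size q) {[p`_i, q`_j]} *: 'X^(i + j)) le_pn).
rewrite big_mkcond /=.
apply: eq_bigr => i _; case: ltnP => [_|le_pi].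
  rewrite /map_poly poly_def mulr_suml; apply: eq_bigr => j _.
  by rewrite -scalerAl -exprD addnC.
rewrite nth_default //; suff -> : map_poly (pbr 0) q = 0 by rewrite mul0r.
by apply/polyP => j; rewrite coef_map /= pbr0l coef0.
Qed.

Lemma coef_brC p q : coef_br p q = - coef_br q p.
Proof.
rewrite /coef_br exchange_big -sumrN; apply: eq_bigr => j _ /=.
rewrite -sumrN; apply: eq_bigr => i _.
by rewrite pbrC scaleNr addnC.
Qed.

Lemma coef_brDr p : {morph coef_br p : q r / q + r}.
Proof.
move=> q r; rewrite !(@coef_brE p _ (size p)) // -big_split /=.
by apply: eq_bigr => i _; rewrite raddfD mulrDl.
Qed.

Lemma map_poly_derivation (d : {linear A -> A}) : derivation d ->
  forall p q, map_poly d (p * q) = map_poly d p * q + p * map_poly d q.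
Proof.
move=> dM p q; apply/polyP => n; rewrite coefD coef_map !coefM raddf_sum -big_split /=.
by apply: eq_bigr => i _; rewrite dM !coef_map.
Qed.

Lemma coef_brMr p q r : coef_br p (q * r) = coef_br p q * r + q * coef_br p r.
Proof.
rewrite !(@coef_brE p _ (size p)) // mulr_suml mulr_sumr -big_split /=.
apply: eq_bigr => i _; rewrite (@map_poly_derivation (pbr p`_i)); first by ring.
by move=> a b; rewrite /= pbrMr.
Qed.

Lemma ore_ad_additive q r : ore_ad (q + r) = ore_ad q + ore_ad r.
Proof. by rewrite /ore_ad !raddfD /=; ring. Qed.

Lemma ore_brC p q : ore_br p q = - ore_br q p.
Proof. by rewrite /ore_br coef_brC; ring. Qed.

Lemma ore_brDr p : {morph ore_br p : q r / q + r}.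
Proof. by move=> q r; rewrite /ore_br coef_brDr ore_ad_additive derivD; ring. Qed.

Lemma ore_brCC a b : ore_br a%:P b%:P = {[a, b]}%:P.
Proof.
rewrite /ore_br !derivC mul0r mulr0 subr0 addr0.
rewrite (@coef_brE _ _ 1) ?size_polyC ?leq_b1 // big_ord1 mulr1 coefC eqxx.
by rewrite map_polyC.
Qed.

Lemma map_poly_derivationX (d : {linear A -> A}) : derivation d ->
  map_poly d 'X = 0.
Proof.
move=> dM; apply/polyP => j; rewrite coef_map coefX coef0 /=.
by case: (j == 1)%N; rewrite /= ?derivation1 ?raddf0.
Qed.

Lemma coef_brXr p : coef_br p 'X = 0.
Proof.
rewrite (@coef_brE p _ (size p)) // big1 // => i _.
rewrite (@map_poly_derivationX (pbr p`_i)) ?mul0r // => a b /=.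
exact: pbrMr.
Qed.

Hypotheses (halpha : poisson_derivation alpha).
Hypothesis (hdelta : poisson_skew_derivation alpha delta).

Lemma ore_adM q r : ore_ad (q * r) = ore_ad q * r + q * ore_ad r.
Proof.
rewrite /ore_ad (map_poly_derivation halpha.1) (map_poly_derivation hdelta.1).
by ring.
Qed.

Lemma ore_adX : ore_ad 'X = 0.
Proof.
rewrite /ore_ad !map_poly_derivationX ?mulr0 ?addr0 //.
  exact: hdelta.1.
exact: halpha.1.
Qed.

Lemma ore_brXC a : ore_br 'X a%:P = (alpha a)%:P * 'X + (delta a)%:P.
Proof.
rewrite /ore_br coef_brC coef_brXr derivX derivC mul1r mulr0 subr0 oppr0 add0r.
by rewrite /ore_ad !map_polyC /= mulrC.
Qed.

Lemma ore_brXX : ore_br 'X 'X = 0.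
Proof. by rewrite /ore_br coef_brXr ore_adX derivX; ring. Qed.

Lemma ore_brMr p q r : ore_br p (q * r) = ore_br p q * r + q * ore_br p r.
Proof. by rewrite /ore_br coef_brMr ore_adM derivM; ring. Qed.

Lemma poly_der_eq0 (T : {poly A} -> {poly A}) :
  {morph T : p q / p + q} ->
  (forall p q, T (p * q) = T p * q + p * T q) ->
  (forall a, T a%:P = 0) -> T 'X = 0 -> forall p, T p = 0.
Proof.
move=> TD TM TC TX; elim/poly_ind => [|p c Tp]; first exact: (TC 0).
by rewrite TD TM Tp TX TC mul0r mulr0 !addr0.
Qed.

Let jac p q r :=
  ore_br p (ore_br q r) + ore_br q (ore_br r p) + ore_br r (ore_br p q).

Let jac3 p q : (forall a, jac p q a%:P = 0) -> jac p q 'X = 0 ->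
  forall r, jac p q r = 0.
Proof.
apply: poly_der_eq0; first exact: (jacD ore_brDr ore_brC).
exact: (jacM ore_brDr ore_brC ore_brMr).
Qed.

Let jacC p q r : jac p q r = jac q r p.
Proof. exact: (jac_cycle ore_br). Qed.

Lemma ore_br0r p : ore_br p 0 = 0.
Proof. by apply: (addrI (ore_br p 0)); rewrite -ore_brDr !addr0. Qed.

Lemma ore_brNr p q : ore_br p (- q) = - ore_br p q.
Proof. by apply: (addrI (ore_br p q)); rewrite -ore_brDr !subrr ore_br0r. Qed.

Let jacXCC a b : jac 'X a%:P b%:P = 0.
Proof.
rewrite /jac [ore_br b%:P 'X]ore_brC ore_brNr ore_brCC !ore_brXC.
rewrite !ore_brDr !ore_brMr !ore_brCC ![ore_br _ 'X]ore_brC !ore_brXC.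
rewrite hdelta.2 halpha.2 [{[b, _]}]pbrC [{[b, delta a]}]pbrC.
by rewrite !(polyCD, polyCN, polyCM); ring.
Qed.

Let jacXXp p : jac 'X 'X p = 0.
Proof.
rewrite /jac ore_brXX ore_br0r [ore_br p 'X]ore_brC ore_brNr.
by rewrite subrr addr0.
Qed.

Lemma ore_br_jacobi p q r : jac p q r = 0.
Proof.
have jXCr a s : jac 'X a%:P s = 0.
  by apply: jac3 => [b|]; rewrite ?jacXCC // jacC jacC jacXXp.
have jXr s t : jac 'X s t = 0.
  apply: jac3 => [b|]; last by rewrite jacC jacC jacXXp.
  rewrite jacC jacC; apply: (@poly_der_eq0 (fun u => jac b%:P 'X u)).
  - exact: (jacD ore_brDr ore_brC).
  - exact: (jacM ore_brDr ore_brC ore_brMr).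
  - by move=> c; rewrite jacC jacXCC.
  - by rewrite jacC jacXXp.
have jCC a b s : jac a%:P b%:P s = 0.
  apply: jac3 => [c|]; last by rewrite jacC jacC jXr.
  by rewrite /jac !ore_brCC -!polyCD pbr_jacobi.
have jC a s t : jac a%:P s t = 0.
  apply: jac3 => [b|]; rewrite jacC jacC ?jCC ?jXr //.
by apply: jac3 => [b|]; rewrite jacC jacC ?jC ?jXr.
Qed.

End OreBracket.

(* {poly A} is canonically an algebra over A only; ore carries the K-algebra
   structure and the Poisson bracket. *)
Section OreAlgebra.
Variables (K : fieldType) (A : poissonAlgType K) (alpha delta : {linear A -> A}).

Definition ore of poisson_derivation alpha
  & poisson_skew_derivation alpha delta := {poly A}.

Variables (halpha : poisson_derivation alpha).
Variable (hdelta : poisson_skew_derivation alpha delta).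
Local Notation oreP := (ore halpha hdelta).

HB.instance Definition _ := GRing.ComNzRing.on oreP.

Definition ore_scale (k : K) (p : oreP) : oreP := (k%:A : A)%:P * p.

Fact ore_scaleA k l (p : oreP) :
  ore_scale k (ore_scale l p) = ore_scale (k * l) p.
Proof.
by rewrite /ore_scale mulrA -polyCM -scalerAl mul1r scalerA.
Qed.

Fact ore_scale1 : left_id 1 ore_scale.
Proof. by move=> p; rewrite /ore_scale scale1r mul1r. Qed.

Fact ore_scaleDr : right_distributive ore_scale +%R.
Proof. by move=> k p q; rewrite /ore_scale mulrDr. Qed.

Fact ore_scaleDl (p : oreP) : {morph ore_scale^~ p : k l / k + l}.
Proof. by move=> k l; rewrite /ore_scale scalerDl polyCD mulrDl. Qed.

HB.instance Definition _ := GRing.Zmodule_isLmodule.Build K oreP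
  ore_scaleA ore_scale1 ore_scaleDr ore_scaleDl.

Fact ore_scaleAl (k : K) (p q : oreP) : k *: (p * q) = k *: p * q.
Proof. exact: mulrA. Qed.

HB.instance Definition _ := GRing.Lmodule_isLalgebra.Build K oreP ore_scaleAl.

Fact ore_scaleAr (k : K) (p q : oreP) : k *: (p * q) = p * (k *: q).
Proof. exact: mulrCA. Qed.

HB.instance Definition _ := GRing.Lalgebra_isAlgebra.Build K oreP ore_scaleAr.

Fact ore_pbr_linearl (k : K) (p q r : oreP) :
  ore_br alpha delta (k *: p + q) r
  = k *: (ore_br alpha delta p r : oreP) + ore_br alpha delta q r.
Proof.
have brC1 (s : {poly A}) : ore_br alpha delta s (k%:A)%:P = 0.
  apply: (poly_der_eq0 (T := fun s => ore_br alpha delta s (k%:A)%:P)).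
  - by move=> u v; rewrite !(ore_brC alpha delta _ _%:P) ore_brDr opprD.
  - move=> u v; rewrite !(ore_brC alpha delta _ _%:P) ore_brMr //; ring.
  - move=> a; rewrite ore_brCC pbrZr.
    by rewrite (derivation1 (d := pbr a)) ?scaler0 // => b c; exact: pbrMr.
  - rewrite ore_brXC !linearZ /= !derivation1 ?scaler0 ?mul0r ?addr0 //.
      exact: hdelta.1.
    exact: halpha.1.
rewrite ore_brC ore_brDr (ore_brMr halpha hdelta) brC1 mul0r add0r opprD.
by rewrite -mulrN -!ore_brC.
Qed.

HB.instance Definition _ := isPoisson.Build K oreP ore_pbr_linearl
  (ore_brC alpha delta) (ore_brMr halpha hdelta) (ore_br_jacobi halpha hdelta).

Definition oreC (a : A) : oreP := a%:P.
Definition oreX : oreP := 'X.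

Fact oreC_is_linear : linear oreC.
Proof.
by move=> k a b; rewrite /oreC polyCD -[k *: a](mulr_algl k a) polyCM.
Qed.

Fact oreC_is_monoid_morphism : monoid_morphism oreC.
Proof. by split=> // a b; rewrite /oreC polyCM. Qed.

HB.instance Definition _ :=
  GRing.isLinear.Build K A oreP *:%R oreC oreC_is_linear.
HB.instance Definition _ :=
  GRing.isMonoidMorphism.Build A oreP oreC oreC_is_monoid_morphism.

Lemma ore_pbrC a b : {[oreC a, oreC b]} = oreC {[a, b]}.
Proof. exact: ore_brCC. Qed.

Lemma ore_pbrX a : {[oreX, oreC a]} = oreC (alpha a) * oreX + oreC (delta a).
Proof. exact: ore_brXC. Qed.

Lemma ore_pbrXX : {[oreX, oreX]} = 0.
Proof. exact: ore_brXX. Qed.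

Lemma ore_pbr_unique (br : oreP -> oreP -> oreP) :
  (forall r, {morph br r : p q / p + q}) ->
  (forall p q, br p q = - br q p) ->
  (forall p q r, br p (q * r) = br p q * r + q * br p r) ->
  (forall a b, br (oreC a) (oreC b) = oreC {[a, b]}) ->
  (forall a, br oreX (oreC a) = oreC (alpha a) * oreX + oreC (delta a)) ->
  br oreX oreX = 0 ->
  forall p q, br p q = {[p, q]}.
Proof.
move=> brD brC brM brCC brXC brXX.
have ext p : (forall a, br p (oreC a) = {[p, oreC a]}) ->
    br p oreX = {[p, oreX]} -> forall q, br p q = {[p, q]}.
  move=> eqC eqX q; apply/eqP; rewrite -subr_eq0; apply/eqP.
  apply: (poly_der_eq0 (T := fun q => br p q - {[p, q : oreP]})).
  - by move=> u v; rewrite brD (pbrDr (A := oreP)); ring.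
  - by move=> u v; rewrite brM (pbrMr (s := oreP)); ring.
  - by move=> a; rewrite eqC subrr.
  - by rewrite eqX subrr.
have extC a : forall q, br (oreC a) q = {[oreC a, q]}.
  apply: ext => [b|]; first by rewrite brCC ore_pbrC.
  by rewrite brC brXC pbrC ore_pbrX.
have extX : forall q, br oreX q = {[oreX, q]}.
  by apply: ext => [a|]; rewrite ?brXC ?ore_pbrX ?brXX ?ore_pbrXX.
by move=> p; apply: ext => [a|]; rewrite brC pbrC ?extC ?extX.
Qed.

End OreAlgebra.

(* The localisation of a commutative ring at the powers of a regular element x;
   the pair (p, m) represents p / x ^ m. *)
Module Loc.
Section Loc.
Variables (R : comNzRingType) (x : R).
Hypothesis xreg : GRing.lreg x.
Implicit Types u v w : R * nat.

Definition equiv u v := u.1 * x ^+ v.2 == v.1 * x ^+ u.2.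

Lemma xnreg n : injective ( *%R^~ (x ^+ n)).
Proof. by move=> a b; rewrite /= ![_ * x ^+ n]mulrC => /(lregX (n := n) xreg). Qed.

Lemma equiv_refl : reflexive equiv. Proof. by move=> u; apply: eqxx. Qed.
Lemma equiv_sym : symmetric equiv.
Proof. by move=> u v; rewrite /equiv eq_sym. Qed.
Lemma equiv_trans : transitive equiv.
Proof.
move=> v u w /eqP uv /eqP vw; apply/eqP/(xnreg (n := v.2)).
by rewrite /= mulrAC uv mulrAC vw mulrAC.
Qed.

Canonical equiv_equiv := EquivRel equiv equiv_refl equiv_sym equiv_trans.

Definition type := {eq_quot equiv}.
HB.instance Definition _ : EqQuotient _ equiv type := EqQuotient.on type.
HB.instance Definition _ := Choice.on type.

Definition frac (p : R) (m : nat) : type := \pi_type (p, m).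

Lemma fracP (a : type) : exists p m, a = frac p m.
Proof. by elim/quotW: a => -[p m]; exists p, m. Qed.

Lemma frac_eq p m q n : frac p m = frac q n <-> p * x ^+ n = q * x ^+ m.
Proof. by split => [/eqmodP/eqP|e] //; apply/eqmodP/eqP. Qed.

Lemma repr_frac p m :
  p * x ^+ (repr (frac p m)).2 = (repr (frac p m)).1 * x ^+ m.
Proof.
apply/frac_eq; rewrite -[LHS]reprK /frac.
by case: (repr _).
Qed.

Definition lift2 (f : R * nat -> R * nat -> R * nat) (a b : type) : type :=
  \pi_type (f (repr a) (repr b)).

Lemma lift2E f :
  (forall u u' v, equiv u u' -> equiv (f u v) (f u' v)) ->
  (forall u v v', equiv v v' -> equiv (f u v) (f u v')) ->
  forall p m q n, lift2 f (frac p m) (frac q n) = \pi_type (f (p, m) (q, n)).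
Proof.
move=> fl fr p m q n; apply/esym/eqmodP.
have e r k : equiv (r, k) (repr (frac r k)) by apply/eqP/repr_frac.
exact: equiv_trans (fl _ _ _ (e p m)) (fr _ _ _ (e q n)).
Qed.

Definition addl := lift2 (fun u v => (u.1 * x ^+ v.2 + v.1 * x ^+ u.2, (u.2 + v.2)%N)).
Definition mull := lift2 (fun u v => (u.1 * v.1, (u.2 + v.2)%N)).
Definition oppl := mull (frac (-1) 0).

Lemma addE p m q n :
  addl (frac p m) (frac q n) = frac (p * x ^+ n + q * x ^+ m) (m + n).
Proof.
rewrite /addl lift2E // => [u u' v|u v v'] /eqP e; apply/eqP;
  rewrite /= !exprD !mulrDl.
  have -> : u.1 * x ^+ v.2 * (x ^+ u'.2 * x ^+ v.2)
    = (u.1 * x ^+ u'.2) * (x ^+ v.2 * x ^+ v.2) by ring.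
  by rewrite e; ring.
have -> : v.1 * x ^+ u.2 * (x ^+ u.2 * x ^+ v'.2)
  = (v.1 * x ^+ v'.2) * (x ^+ u.2 * x ^+ u.2) by ring.
by rewrite e; ring.
Qed.

Lemma mulE p m q n : mull (frac p m) (frac q n) = frac (p * q) (m + n).
Proof.
rewrite /mull lift2E // => [u u' v|u v v'] /eqP e; apply/eqP; rewrite /= !exprD.
  have -> : u.1 * v.1 * (x ^+ u'.2 * x ^+ v.2)
    = (u.1 * x ^+ u'.2) * (v.1 * x ^+ v.2) by ring.
  by rewrite e; ring.
have -> : u.1 * v.1 * (x ^+ u.2 * x ^+ v'.2)
    = (v.1 * x ^+ v'.2) * (u.1 * x ^+ u.2) by ring.
by rewrite e; ring.
Qed.

Fact addlA : associative addl.
Proof.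
move=> a b c; have [p [m ->]] := fracP a; have [q [n ->]] := fracP b;
have [r [k ->]] := fracP c; rewrite !addE; apply/frac_eq; rewrite !exprD; ring.
Qed.
Fact addlC : commutative addl.
Proof.
move=> a b; have [p [m ->]] := fracP a; have [q [n ->]] := fracP b.
by rewrite !addE; apply/frac_eq; rewrite !exprD; ring.
Qed.
Fact add0l : left_id (frac 0 0) addl.
Proof.
move=> a; have [p [m ->]] := fracP a.
by rewrite !addE; apply/frac_eq; rewrite !exprD expr0; ring.
Qed.
Fact addNl : left_inverse (frac 0 0) oppl addl.
Proof.
move=> a; have [p [m ->]] := fracP a.
by rewrite /oppl mulE addE; apply/frac_eq; rewrite !exprD expr0; ring.
Qed.

HB.instance Definition _ := GRing.isZmodule.Build type addlA addlC add0l addNl.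

Fact mullA : associative mull.
Proof.
move=> a b c; have [p [m ->]] := fracP a; have [q [n ->]] := fracP b.
by have [r [k ->]] := fracP c; rewrite !mulE mulrA addnA.
Qed.
Fact mullC : commutative mull.
Proof.
move=> a b; have [p [m ->]] := fracP a; have [q [n ->]] := fracP b.
by rewrite !mulE mulrC addnC.
Qed.
Fact mul1l : left_id (frac 1 0) mull.
Proof. by move=> a; have [p [m ->]] := fracP a; rewrite mulE mul1r add0n. Qed.
Fact mullDl : left_distributive mull addl.
Proof.
move=> a b c; have [p [m ->]] := fracP a; have [q [n ->]] := fracP b;
have [r [k ->]] := fracP c; rewrite !(addE, mulE); apply/frac_eq; rewrite !exprD; ring.
Qed.
Fact nonzero1 : frac 1 0 != frac 0 0.
Proof. by apply/eqP => /frac_eq/eqP; rewrite expr0 !mulr1 oner_eq0. Qed.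

HB.instance Definition _ :=
  GRing.Zmodule_isComNzRing.Build type mullA mullC mul1l mullDl nonzero1.

End Loc.
End Loc.
HB.export Loc.

Section LocPoisson.
Variables (K : fieldType) (P : poissonAlgType K) (x : P) (xreg : GRing.lreg x).
Implicit Types (p q r : P) (m n : nat) (k l : K).

Definition loc := Loc.type xreg.
Definition loc_frac p m : loc := Loc.frac xreg p m.

HB.instance Definition _ := GRing.ComNzRing.on loc.

Lemma loc_fracP (a : loc) : exists p m, a = loc_frac p m.
Proof. exact: Loc.fracP. Qed.

Lemma loc_frac_eq p m q n :
  loc_frac p m = loc_frac q n <-> p * x ^+ n = q * x ^+ m.
Proof. exact: Loc.frac_eq. Qed.

Lemma loc_fracM p m q n :
  loc_frac p m * loc_frac q n = loc_frac (p * q) (m + n).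
Proof. exact: Loc.mulE. Qed.

Lemma loc_fracD p q m : loc_frac p m + loc_frac q m = loc_frac (p + q) m.
Proof.
rewrite [LHS]Loc.addE; apply/loc_frac_eq; rewrite exprD; ring.
Qed.

Lemma loc_fracMX p m n : loc_frac p m = loc_frac (p * x ^+ n) (m + n).
Proof. by apply/loc_frac_eq; rewrite exprD; ring. Qed.

Lemma loc_frac_same (a b : loc) :
  exists p q m, a = loc_frac p m /\ b = loc_frac q m.
Proof.
have [p [m ->]] := loc_fracP a; have [q [n ->]] := loc_fracP b.
exists (p * x ^+ n), (q * x ^+ m), (m + n)%N; split; first exact: loc_fracMX.
by rewrite addnC; exact: loc_fracMX.
Qed.

Definition loc_scale (k : K) (a : loc) : loc := loc_frac k%:A 0 * a.

Fact loc_scale_frac (k : K) p m : loc_scale k (loc_frac p m) = loc_frac (k *: p) m.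
Proof. by rewrite /loc_scale loc_fracM mulr_algl. Qed.

Fact loc_scaleA k l (a : loc) : loc_scale k (loc_scale l a) = loc_scale (k * l) a.
Proof.
by have [p [m ->]] := loc_fracP a; rewrite !loc_scale_frac scalerA.
Qed.

Fact loc_scale1 : left_id 1 loc_scale.
Proof.
by move=> a; have [p [m ->]] := loc_fracP a; rewrite loc_scale_frac scale1r.
Qed.

Fact loc_scaleDr : right_distributive loc_scale +%R.
Proof. by move=> k a b; rewrite /loc_scale mulrDr. Qed.

Fact loc_scaleDl (a : loc) : {morph loc_scale^~ a : k l / k + l}.
Proof.
move=> k l; have [p [m ->]] := loc_fracP a.
by rewrite !loc_scale_frac loc_fracD scalerDl.
Qed.

HB.instance Definition _ := GRing.Zmodule_isLmodule.Build K loc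
  loc_scaleA loc_scale1 loc_scaleDr loc_scaleDl.

Fact loc_scaleAl (k : K) (a b : loc) : k *: (a * b) = k *: a * b.
Proof. exact: mulrA. Qed.

HB.instance Definition _ := GRing.Lmodule_isLalgebra.Build K loc loc_scaleAl.

Fact loc_scaleAr (k : K) (a b : loc) : k *: (a * b) = a * (k *: b).
Proof. exact: mulrCA. Qed.

HB.instance Definition _ := GRing.Lalgebra_isAlgebra.Build K loc loc_scaleAr.

(* {p / x^m, q / x^n}
     = {p, q} / x^(m+n) - n q {p, x} / x^(m+n+1) - m p {x, q} / x^(m+n+1)
       + m n p q {x, x} / x^(m+n+2);
   the last term vanishes unless 2 = 0 in K. *)
Definition loc_br_num (u v : P * nat) : P * nat :=
  (x ^+ 2 * {[u.1, v.1]} - x * v.1 * {[u.1, x]} *+ v.2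
     - x * u.1 * {[x, v.1]} *+ u.2 + u.1 * v.1 * {[x, x]} *+ (u.2 * v.2),
   (u.2 + v.2 + 2)%N).

Definition loc_br : loc -> loc -> loc := Loc.lift2 (xreg := xreg) loc_br_num.

Lemma pbrXr p n : x * {[p, x ^+ n]} = x ^+ n * {[p, x]} *+ n.
Proof.
elim: n => [|n IHn].
  by rewrite expr0 (derivation1 (d := pbr p)) ?mulr0 // => a b; exact: pbrMr.
by rewrite exprS pbrMr mulrDr [x * (x * _)]mulrCA IHn; ring.
Qed.

Lemma loc_num_compat c p m q n : p * x ^+ n = q * x ^+ m ->
  (x * {[c, p]} - p * {[c, x]} *+ m) * x ^+ n
  = (x * {[c, q]} - q * {[c, x]} *+ n) * x ^+ m.
Proof.
move=> e; have := congr1 (fun t => x * {[c, t]}) e.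
rewrite !pbrMr !mulrDr [x * (p * _)]mulrCA [x * (q * _)]mulrCA !pbrXr => E.
have {}E : x * ({[c, p]} * x ^+ n) =
  x * ({[c, q]} * x ^+ m) + q * (x ^+ m * {[c, x]} *+ m)
    - p * (x ^+ n * {[c, x]} *+ n) by rewrite -E addrK.
have -> : (x * {[c, p]} - p * {[c, x]} *+ m) * x ^+ n
  = x * ({[c, p]} * x ^+ n) - (p * x ^+ n) * {[c, x]} *+ m by ring.
rewrite E e.
have -> : p * (x ^+ n * {[c, x]} *+ n) = (p * x ^+ n) * {[c, x]} *+ n by ring.
by rewrite e; ring.
Qed.

Lemma loc_br_numC u v :
  loc_br_num u v = (- (loc_br_num v u).1, (loc_br_num v u).2).
Proof.
rewrite /loc_br_num /= (addnC u.2) (mulnC u.2) [{[u.1, v.1]}]pbrC.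
rewrite [{[u.1, x]}]pbrC [{[x, v.1]}]pbrC {1}[{[x, x]}]pbrC; congr pair; ring.
Qed.

Lemma loc_brE p m q n :
  loc_br (loc_frac p m) (loc_frac q n)
  = loc_frac (loc_br_num (p, m) (q, n)).1 (m + n + 2).
Proof.
have comp (u v v' : P * nat) : Loc.equiv x v v' ->
    Loc.equiv x (loc_br_num u v) (loc_br_num u v').
  case: u v v' => [p' i] [q' j] [r' k] /eqP /= e.
  apply/eqP; rewrite /loc_br_num /= !exprD.
  have e1 := loc_num_compat p' e; have e2 := loc_num_compat x e.
  have -> : (x ^+ 2 * {[p', q']} - x * q' * {[p', x]} *+ j
      - x * p' * {[x, q']} *+ i + p' * q' * {[x, x]} *+ (i * j))
      * (x ^+ i * x ^+ k * x ^+ 2)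
    = x ^+ i * x ^+ 2 * (x * ((x * {[p', q']} - q' * {[p', x]} *+ j) * x ^+ k)
        - p' * ((x * {[x, q']} - q' * {[x, x]} *+ j) * x ^+ k) *+ i).
    by rewrite mulrnA; ring.
  by rewrite e1 e2 mulrnA; ring.
rewrite /loc_br /loc_frac Loc.lift2E // => u u' v e.
by rewrite loc_br_numC [loc_br_num u' v]loc_br_numC;
  move: (comp v u u' e); rewrite /Loc.equiv /= !mulNr eqr_opp.
Qed.

Lemma loc_brC (a b : loc) : loc_br a b = - loc_br b a.
Proof.
have [p [m ->]] := loc_fracP a; have [q [n ->]] := loc_fracP b.
rewrite -mulN1r -[- 1]/(loc_frac (-1) 0 * loc_frac 1 0) !loc_brE !loc_fracM.
by rewrite loc_br_numC mulr1 mulN1r !add0n (addnC m).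
Qed.

Lemma loc_brDr (c : loc) : {morph loc_br c : a b / a + b}.
Proof.
move=> a b; have [r [k ->]] := loc_fracP c.
have [p [q [m [-> ->]]]] := loc_frac_same a b.
rewrite loc_fracD !loc_brE loc_fracD; congr loc_frac.
by rewrite /loc_br_num /= !pbrDr; ring.
Qed.

Fact loc_br_linearl (k : K) (a b c : loc) :
  loc_br (k *: a + b) c = k *: loc_br a c + loc_br b c.
Proof.
rewrite loc_brC loc_brDr opprD -!loc_brC; congr (_ + _).
have [r [n ->]] := loc_fracP c; have [p [m ->]] := loc_fracP a.
rewrite [k *: _]loc_scale_frac !loc_brE [RHS]loc_scale_frac; congr loc_frac.
have kE (t : P) : k *: t = k%:A * t by rewrite mulr_algl.
rewrite /loc_br_num /= !pbrZl; by move: (k%:A) kE => t kE; rewrite !kE; ring.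
Qed.

Fact loc_brMr (a b c : loc) : loc_br a (b * c) = loc_br a b * c + b * loc_br a c.
Proof.
have [p [m ->]] := loc_fracP a; have [q [n ->]] := loc_fracP b.
have [r [k ->]] := loc_fracP c.
rewrite loc_fracM !loc_brE !loc_fracM.
rewrite -!addnA [(2 + k)%N]addnC [(n + (m + _))%N]addnCA loc_fracD.
congr loc_frac; rewrite /loc_br_num /= !pbrMr mulnDr; ring.
Qed.

Lemma loc_der_eq0 (T : loc -> loc) :
  (forall a b, T (a * b) = T a * b + a * T b) ->
  (forall p, T (loc_frac p 0) = 0) -> forall a, T a = 0.
Proof.
move=> TM T0 a; have [p [m ->]] := loc_fracP a.
have unitX : loc_frac (x ^+ m) 0 * loc_frac 1 m = 1.
  by rewrite loc_fracM; apply/loc_frac_eq; rewrite expr0 !mulr1 mul1r.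
rewrite -[LHS]mulr1 -unitX mulrA.
suff -> : T (loc_frac p m) * loc_frac (x ^+ m) 0 = 0 by rewrite mul0r.
apply: (addIr (loc_frac p m * T (loc_frac (x ^+ m) 0))).
rewrite -TM loc_fracM T0 mulr0 addr0 -[RHS](T0 p); congr T.
by apply/loc_frac_eq; rewrite addn0 expr0 mulr1.
Qed.

Lemma loc_br_int p q :
  loc_br (loc_frac p 0) (loc_frac q 0) = loc_frac {[p, q]} 0.
Proof.
rewrite loc_brE; apply/loc_frac_eq; rewrite /loc_br_num /= expr0; ring.
Qed.

Fact loc_br_jacobi (a b c : loc) :
  loc_br a (loc_br b c) + loc_br b (loc_br c a) + loc_br c (loc_br a b) = 0.
Proof.
pose jac a b c :=
  loc_br a (loc_br b c) + loc_br b (loc_br c a) + loc_br c (loc_br a b).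
rewrite -/(jac a b c).
have jacC u v w : jac u v w = jac v w u := jac_cycle loc_br u v w.
have jac3 u v : (forall p, jac u v (loc_frac p 0) = 0) -> forall w, jac u v w = 0.
  by apply: loc_der_eq0; exact: (jacM loc_brDr loc_brC loc_brMr).
apply: (jac3) => r; rewrite jacC jacC.
apply: (jac3) => q; rewrite jacC jacC.
apply: (jac3) => p; rewrite /jac !loc_br_int !loc_fracD pbr_jacobi.
by apply/loc_frac_eq.
Qed.

HB.instance Definition _ := isPoisson.Build K loc
  loc_br_linearl loc_brC loc_brMr loc_br_jacobi.

Definition to_loc p : loc := loc_frac p 0.

Fact to_loc_is_linear : linear to_loc.
Proof. by move=> k p q; rewrite [k *: to_loc p]loc_scale_frac loc_fracD. Qed.

Fact to_loc_is_monoid_morphism : monoid_morphism to_loc.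
Proof. by split=> // p q; rewrite loc_fracM. Qed.

HB.instance Definition _ := GRing.isLinear.Build K P loc *:%R to_loc to_loc_is_linear.
HB.instance Definition _ :=
  GRing.isMonoidMorphism.Build P loc to_loc to_loc_is_monoid_morphism.

Lemma to_loc_pbr p q : {[to_loc p, to_loc q]} = to_loc {[p, q]}.
Proof. exact: loc_br_int. Qed.

Definition locXV : loc := loc_frac 1 1.

Lemma locXVK : to_loc x * locXV = 1.
Proof. by rewrite loc_fracM; apply/loc_frac_eq; rewrite expr0 !mulr1 mul1r. Qed.

Lemma loc_fracE p m : loc_frac p m = to_loc p * locXV ^+ m.
Proof.
suff -> : locXV ^+ m = loc_frac 1 m by rewrite loc_fracM mulr1.
by elim: m => // m IHm; rewrite exprS IHm loc_fracM mulr1.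
Qed.

Lemma loc_pbr_unique (br : loc -> loc -> loc) :
  (forall c, {morph br c : a b / a + b}) ->
  (forall a b, br a b = - br b a) ->
  (forall a b c, br a (b * c) = br a b * c + b * br a c) ->
  (forall p q, br (to_loc p) (to_loc q) = to_loc {[p, q]}) ->
  forall a b, br a b = {[a, b]}.
Proof.
move=> brD brC brM brE.
have ext a : (forall p, br a (to_loc p) = {[a, to_loc p]}) ->
    forall b, br a b = {[a, b]}.
  move=> e b; apply/eqP; rewrite -subr_eq0; apply/eqP.
  apply: (loc_der_eq0 (T := fun b => br a b - {[a, b]})) => [u v|p].
    by rewrite brM pbrMr; ring.
  by rewrite -/(to_loc p) e subrr.
move=> a; apply: (ext) => p; rewrite brC pbrC; congr (- _); apply: ext => q.
by rewrite brE to_loc_pbr.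
Qed.

End LocPoisson.

Section OreLaurent.
Variables (K : fieldType) (A : poissonAlgType K) (alpha delta : {linear A -> A}).
Variables (halpha : poisson_derivation alpha).
Variable (hdelta : poisson_skew_derivation alpha delta).

Lemma oreX_lreg : GRing.lreg (oreX halpha hdelta).
Proof. exact: (monic_lreg (monicX A)). Qed.

Definition ore_laurent : poissonAlgType K := loc oreX_lreg.

Definition laurentC (a : A) : ore_laurent := to_loc oreX_lreg (oreC halpha hdelta a).
Definition laurentX : ore_laurent := to_loc oreX_lreg (oreX halpha hdelta).
Definition laurentXV : ore_laurent := locXV oreX_lreg.

Lemma laurentXVK : laurentX * laurentXV = 1.
Proof. exact: locXVK. Qed.

Lemma laurent_pbrC a b : {[laurentC a, laurentC b]} = laurentC {[a, b]}.
Proof. by rewrite [LHS]to_loc_pbr ore_pbrC. Qed.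

Lemma laurent_pbrX a :
  {[laurentX, laurentC a]} = laurentC (alpha a) * laurentX + laurentC (delta a).
Proof. by rewrite [LHS]to_loc_pbr ore_pbrX rmorphD rmorphM. Qed.

End OreLaurent.

(* Main.v *)
Require Import Defs.
From HB Require Import structures.
From mathcomp Require Import all_boot all_algebra.
From mathcomp Require Import ring zify.
From mathcomp Require Import boolp classical_sets fsbigop.

(* Write y = X^-1 and u = y / eta, so that F(a) = sum_i D_i(a) u^i; the Leibniz
   rule for (D_i) makes F multiplicative, and {D_i a, u^n} is computed from
   {a, u} = alpha(a) u + eta delta(a) u^2.  Since delta D_i = (i + 1) D_(i+1),
   sum_i delta(D_i a) u^(i+1) = E(a) where E(a) := sum_i i D_i(a) u^i,
   and the bracket of F(a) and F(b) becomes
     sum_(i, j) {D_i a, D_j b} u^(i + j) + A(a) E(b) - E(a) A(b)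
   with A(a) := sum_i alpha(D_i a) u^i (the terms E(a) E(b) cancel); this is
   F({a, b}) by the skew Poisson identity for D_n.  The inverse of the extension
   of F is built the same way from - eta instead of eta: iterativity turns the
   composite into sum_n D_n(a) u^n (1 - 1)^n = a. *)

Set Implicit Arguments.
Unset Strict Implicit.
Unset Printing Implicit Defensive.

Import GRing.Theory.
Local Open Scope ring_scope.

(** Reindexing by [n = i + j]: the triangle [i + j < M + N] contains the rectangle, and each extra
    pair has [i >= M] or [j >= N], so its term is zero. *)
Lemma cauchy_sum (V : nmodType) (M N : nat) (t : nat -> nat -> V) :
  (forall i j, (M <= i)%N || (N <= j)%N -> t i j = 0) ->
  \sum_(i < M) \sum_(j < N) t i j
  = \sum_(n < M + N) \sum_(i < n.+1) t i (n - i)%N.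
Proof.
(* The inner range is made independent of [n], with a guard [i <= n], so that the two sums can be
   exchanged. *)
move=> t0; have inner n : (n < M + N)%N ->
    \sum_(i < n.+1) t i (n - i)%N
    = \sum_(0 <= i < M + N | (i <= n)%N) t i (n - i)%N.
  move=> lt_n; rewrite -(big_mkord xpredT (fun i => t i (n - i)%N)).
  by rewrite (big_nat_widen _ _ _ _ _ lt_n).
under [RHS]eq_bigr => n _ do rewrite (inner n (ltn_ord n)).
rewrite -(big_mkord xpredT (fun n => \sum_(0 <= i < M + N | (i <= n)%N) t i (n - i)%N)).
rewrite [RHS](exchange_big_dep_nat xpredT) //=.
rewrite [RHS](big_cat_nat (n := M)) ?leq_addr //= [X in _ + X]big_nat_cond.
rewrite [X in _ = _ + X]big1 ?addr0 => [|i /andP[/andP[leMi _] _]]; last first.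
  by apply: big1 => n _; rewrite t0 ?leMi.
rewrite big_mkord; apply: eq_bigr => i _.
have le_i : (i <= M + N)%N by rewrite (leq_trans (ltnW (ltn_ord i))) ?leq_addr.
rewrite [RHS](big_cat_nat (n := i)) //= [X in X + _]big_nat_cond.
rewrite [X in _ = X + _]big1 ?add0r; last first.
  by move=> n /andP[/andP[_ lt_ni] le_in]; rewrite leqNgt lt_ni in le_in.
rewrite -[X in index_iota X _]add0n big_addn.
under [RHS]eq_bigr => j _ do rewrite addnK.
under [RHS]eq_bigl => j do rewrite leq_addl.
rewrite [RHS](big_cat_nat (n := N)) //=; last by rewrite leq_subRL // leq_add2r ltnW.
rewrite [X in _ + X]big_nat_cond [X in _ = _ + X]big1 ?addr0 ?big_mkord //.
by move=> j /andP[/andP[leNj _] _]; rewrite t0 ?leNj ?orbT.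
Qed.

(** * Maps out of the Laurent algebra, determined on [A] and [X] *)

Section Laurent.
Variables (K : fieldType) (A : poissonAlgType K) (alpha delta : {linear A -> A}).
Variables (halpha : poisson_derivation alpha).
Variable (hdelta : poisson_skew_derivation alpha delta).

Local Notation L := (ore_laurent halpha hdelta).
Local Notation CL := (laurentC halpha hdelta).
Local Notation XL := (laurentX halpha hdelta).
Local Notation XR := (@oreX_lreg _ _ _ _ halpha hdelta).
Local Notation YL := (laurentXV halpha hdelta).

Fact laurentC_is_linear : linear CL.
Proof. by move=> k a b; rewrite /laurentC !linearP. Qed.

Fact laurentC_is_monoid_morphism : monoid_morphism CL.
Proof. by split=> [|a b]; rewrite /laurentC ?rmorph1 ?rmorphM. Qed.

HB.instance Definition _ := GRing.isLinear.Build K A L *:%R CL laurentC_is_linear.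
HB.instance Definition _ :=
  GRing.isMonoidMorphism.Build A L CL laurentC_is_monoid_morphism.

Lemma laurent_pbrXX : {[XL, XL]} = 0.
Proof. by rewrite [LHS]to_loc_pbr ore_pbrXX linear0. Qed.

(* Covers both differences of morphisms (uniqueness) and the defect of a
   morphism with respect to the brackets (where f = g). *)
Lemma laurent_skew_der_eq0 (B : comPzRingType) (f g T : L -> B) :
  {morph T : a b / a + b} ->
  (forall a b, T (a * b) = T a * f b + g a * T b) ->
  monoid_morphism g ->
  (forall a, T (CL a) = 0) -> T XL = 0 -> forall a, T a = 0.
Proof.
move=> TD TM [g1 gM] TC TX.
have T1 : T 1 = 0 by rewrite -[1](rmorph1 CL) TC.
(* Applying [T] to [XL * YL = 1] gives [g XL * T YL = 0], and [g XL] is invertible with inverse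
   [g YL]. *)
have TY : T YL = 0.
  have := TM XL YL; rewrite laurentXVK T1 TX mul0r add0r => /esym gTY.
  by rewrite -[LHS]mul1r -g1 -(laurentXVK halpha hdelta) gM mulrAC gTY mul0r.
have TP (p : ore halpha hdelta) : T (to_loc XR p) = 0.
  elim/poly_ind: p => [|p c Tp]; first by rewrite -(TC 0) /laurentC !linear0.
  rewrite [X in T X](_ : _ = to_loc XR p * XL + CL c).
    by rewrite TD TM Tp TX TC mul0r mulr0 !addr0.
  by rewrite /laurentX /laurentC -rmorphM -linearD.
move=> a; have [p [m ->]] := loc_fracP a.
rewrite loc_fracE TM TP mul0r add0r.
suff -> : T (YL ^+ m) = 0 by rewrite mulr0.
by elim: m => // m IHm; rewrite exprS TM TY IHm mul0r mulr0 addr0.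
Qed.

Lemma laurent_morphism_eq (B : comPzRingType) (f g : L -> B) :
  {morph f : a b / a + b} -> {morph g : a b / a + b} ->
  monoid_morphism f -> monoid_morphism g ->
  (forall a, f (CL a) = g (CL a)) -> f XL = g XL -> f =1 g.
Proof.
move=> fD gD [_ fM] gmor fgC fgX a; apply/eqP; rewrite -subr_eq0; apply/eqP.
apply: (@laurent_skew_der_eq0 B f g (fun a => f a - g a)) a => //=.
- by move=> a b; rewrite fD gD; ring.
- by move=> a b; rewrite fM gmor.2; ring.
- by move=> a; rewrite fgC subrr.
- by rewrite fgX subrr.
Qed.

(** For fixed [a], the defect [f {[a, b]} - {[f a, f b]}] is a derivation in [b] along [f], so each
    argument in turn reduces to the generators. The condition on [{[f XL, f XL]}] is separate
    because skew-symmetry does not force it in characteristic 2. *)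
Lemma laurent_poisson_morphism (B : poissonAlgType K) (f : L -> B) :
  algebra_morphism f ->
  (forall a b, f (CL {[a, b]}) = {[f (CL a), f (CL b)]}) ->
  (forall a, f {[XL, CL a]} = {[f XL, f (CL a)]}) ->
  {[f XL, f XL]} = 0 -> poisson_morphism f.
Proof.
move=> fmor fCC fXC fXX; split=> //; have [flin [f1 fM]] := fmor.
have fD a b : f (a + b) = f a + f b by rewrite -[a]scale1r flin !scale1r.
have f0 : f 0 = 0 by apply: (addrI (f 0)); rewrite -fD !addr0.
have fN a : f (- a) = - f a by apply: (addrI (f a)); rewrite -fD !subrr.
have ext a : (forall c, f {[a, CL c]} = {[f a, f (CL c)]}) ->
    f {[a, XL]} = {[f a, f XL]} -> forall b, f {[a, b]} = {[f a, f b]}.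
  move=> aC aX b; apply/eqP; rewrite -subr_eq0; apply/eqP.
  apply: (@laurent_skew_der_eq0 B f f (fun b => f {[a, b]} - {[f a, f b]})) b.
  - by move=> b c; rewrite pbrDr !fD pbrDr; ring.
  - by move=> b c; rewrite pbrMr !fD !fM pbrMr; ring.
  - by [].
  - by move=> c; rewrite aC subrr.
  - by rewrite aX subrr.
have extC c : forall b, f {[CL c, b]} = {[f (CL c), f b]}.
  apply: ext => [d|]; first by rewrite laurent_pbrC fCC.
  by rewrite pbrC fN fXC -pbrC.
have extX : forall b, f {[XL, b]} = {[f XL, f b]}.
  by apply: ext => [c|]; rewrite ?fXC // laurent_pbrXX f0 fXX.
by move=> a; apply: ext => [c|]; rewrite pbrC fN ?extC ?extX -pbrC.
Qed.

Lemma laurent_morphismXV (B : comPzRingType) (f : L -> B) (y : B) :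
  monoid_morphism f -> f XL * y = 1 -> f YL = y.
Proof.
move=> [f1 fM] fXy; rewrite -[LHS]mulr1 -fXy mulrA -fM.
by rewrite [YL * _]mulrC laurentXVK f1 mul1r.
Qed.

(** * The universal property: extending [f] by [X] to an invertible [x] *)

Section Extension.
Variables (B : comAlgType K) (f : {lrmorphism A -> B}) (x y : B).
Hypothesis xyK : x * y = 1.

Definition laurent_lift (c : L) : B :=
  let: (p, m) := repr (c : Loc.type XR) in
  (map_poly f p).[x] * y ^+ m.

(** Independence of the representative picked by [repr]: [p X^n = q X^m] is evaluated at [x], then
    multiplied by [y^m y^n]. *)
Lemma laurent_lift_frac p m :
  laurent_lift (loc_frac XR p m) = (map_poly f p).[x] * y ^+ m.
Proof.
rewrite /laurent_lift /loc_frac.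
have := Loc.repr_frac XR p m.
case: (repr _) => q n /= e.
have {e} := congr1 (fun r : {poly A} => (map_poly f r).[x]) e.
have evX (r : {poly A}) k :
    (map_poly f (r * 'X^k)).[x] = (map_poly f r).[x] * x ^+ k.
  by rewrite rmorphM /= map_polyXn hornerM hornerXn.
rewrite !evX => e.
have xyn k : x ^+ k * y ^+ k = 1 by rewrite -exprMn xyK expr1n.
have -> : (map_poly f q).[x] * y ^+ n
  = (map_poly f q).[x] * x ^+ m * (y ^+ m * y ^+ n).
  by rewrite -[LHS]mulr1 -(xyn m); ring.
rewrite -e; have -> : (map_poly f p).[x] * x ^+ n * (y ^+ m * y ^+ n)
  = (map_poly f p).[x] * y ^+ m * (x ^+ n * y ^+ n) by ring.
by rewrite xyn mulr1.
Qed.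

Lemma laurent_liftC a : laurent_lift (CL a) = f a.
Proof. by rewrite laurent_lift_frac mulr1 /oreC map_polyC hornerC. Qed.

Lemma laurent_liftX : laurent_lift XL = x.
Proof. by rewrite laurent_lift_frac mulr1 /oreX map_polyX hornerX. Qed.

Lemma laurent_lift_algebra_morphism : algebra_morphism laurent_lift.
Proof.
split=> [k a b|].
  have [p [q [m [-> ->]]]] := loc_frac_same a b.
  rewrite [k *: _]loc_scale_frac loc_fracD !laurent_lift_frac.
  rewrite raddfD hornerD mulrDl /=; congr (_ + _).
  (* The scalar [k] acts on [ore] as multiplication by the constant polynomial [k%:A]. *)
  rewrite rmorphM /= map_polyC hornerM hornerC /=.
  by rewrite linearZ /= rmorph1 mulr_algl scalerAl.
split=> [|a b].
  by rewrite -[1](rmorph1 CL) laurent_liftC rmorph1.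
have [p [m ->]] := loc_fracP a; have [q [n ->]] := loc_fracP b.
by rewrite loc_fracM !laurent_lift_frac rmorphM hornerM exprD; ring.
Qed.

End Extension.

(** * The map [F] on [A] as an algebra morphism *)

Section Expansion.
Variables (eta : K) (D : nat -> {linear A -> A}).
Hypotheses (Dhigher : higher_derivation D) (Dnil : locally_nilpotent D).

Definition expansion (a : A) : L :=
  \sum_(i \in [set: nat]%classic) (eta ^- i *: (CL (D i a) * YL ^+ i)).

Local Notation u := (eta^-1 *: YL : L).

(** Any vanishing bound is allowed, not only the least one, so that several expansions can be
    truncated at a common [N]. *)
Lemma expansionE N a : (forall i, (N <= i)%N -> D i a = 0) ->
  expansion a = \sum_(i < N) CL (D i a) * u ^+ i.
Proof.
move=> DN; have e i : eta ^- i *: (CL (D i a) * YL ^+ i) = CL (D i a) * u ^+ i.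
  by rewrite exprZn exprVn scalerAr.
rewrite /expansion (fsbigE (index_iota 0 N)) ?iota_uniq //; last first.
  move=> i _; rewrite mem_index_iota /= -leqNgt => /DN ->.
  by rewrite linear0 mul0r scaler0.
rewrite -(big_mkord xpredT (fun i => CL (D i a) * u ^+ i)).
by under eq_bigl => i do rewrite in_setT; apply: eq_bigr => i _; rewrite e.
Qed.

Lemma common_bound a b : exists N,
  (forall i, (N <= i)%N -> D i a = 0) /\ (forall i, (N <= i)%N -> D i b = 0).
Proof.
have [m am] := Dnil a; have [n bn] := Dnil b; exists (maxn m n).
by split=> i; rewrite geq_max => /andP[/am ? /bn ?].
Qed.

(** By strong induction the middle terms of [D n (1 * 1)] vanish, which leaves
    [D n 1 = D n 1 + D n 1]. *)
Lemma higher_derivation1 n : (0 < n)%N -> D n 1 = 0.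
Proof.
elim/ltn_ind: n => [[|n]] // IHn _; have := Dhigher.2 n.+1 1 1.
rewrite mulr1 big_ord_recl big_ord_recr /= Dhigher.1 subn0 subnn Dhigher.1.
rewrite big1 => [|i _]; last by rewrite IHn ?mul0r // ltnS ltn_ord.
by rewrite mul1r mulr1 add0r => /esym/eqP; rewrite -subr_eq0 addrK => /eqP.
Qed.

Lemma expansion1 : expansion 1 = 1.
Proof.
rewrite (@expansionE 1) => [|i]; last exact: higher_derivation1.
by rewrite big_ord1 mulr1 Dhigher.1 rmorph1.
Qed.

Lemma expansion_linear : linear expansion.
Proof.
move=> k a b; have [N [aN bN]] := common_bound a b.
have abN i : (N <= i)%N -> D i (k *: a + b) = 0.
  by move=> le_i; rewrite linearP aN ?bN ?scaler0 ?addr0.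
rewrite !(@expansionE N) // scaler_sumr -big_split; apply: eq_bigr => i _ /=.
by rewrite !linearP /= mulrDl scalerAl.
Qed.

Lemma expansionM a b : expansion (a * b) = expansion a * expansion b.
Proof.
have [N [aN bN]] := common_bound a b.
have DD0 i j : (N <= i)%N || (N <= j)%N -> D i a * D j b = 0.
  by case/orP=> [/aN|/bN] ->; rewrite ?mul0r ?mulr0.
(* If [n >= N + N], then [i] or [n - i] is at least [N], so every Leibniz term of [D n (a * b)]
   vanishes. *)
rewrite (expansionE aN) (expansionE bN) (@expansionE (N + N)); last first.
  move=> n le_n; rewrite Dhigher.2 big1 // => i _; apply: DD0.
  by have := ltn_ord i; lia.
rewrite big_distrlr /=.
rewrite (@cauchy_sum _ N N (fun i j => CL (D i a) * u ^+ i * (CL (D j b) * u ^+ j))).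
  apply: eq_bigr => n _; rewrite Dhigher.2 linear_sum mulr_suml.
  apply: eq_bigr => i _; rewrite rmorphM mulrACA -exprD subnKC //.
  by rewrite -ltnS.
by move=> i j /DD0 DD; rewrite mulrACA -rmorphM DD rmorph0 mul0r.
Qed.

Lemma expansion_algebra_morphism : algebra_morphism expansion.
Proof.
by split; [exact: expansion_linear | split; [exact: expansion1 | exact: expansionM]].
Qed.

End Expansion.

(** The quotient rule, from the Leibniz rule on [XL * YL = 1]. *)
Lemma laurent_pbrXV c : {[c, YL]} = - (YL ^+ 2 * {[c, XL]}).
Proof.
have : {[c, XL * YL]} = 0.
  by rewrite laurentXVK (derivation1 (d := pbr c)) // => a b; exact: pbrMr.
rewrite pbrMr => /(congr1 ( *%R YL)).
rewrite mulr0 mulrDr [YL * (XL * _)]mulrA [YL * XL]mulrC laurentXVK mul1r.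
by move/eqP; rewrite addrC addr_eq0 => /eqP ->; congr (- _); ring.
Qed.

Lemma pbr_expr_eq0 (B : poissonAlgType K) (c v : B) n :
  {[c, v]} = 0 -> {[c, v ^+ n]} = 0.
Proof.
move=> cv; elim: n => [|n IHn].
  by rewrite (derivation1 (d := pbr c)) // => a b; exact: pbrMr.
by rewrite exprS pbrMr cv IHn mul0r mulr0 addr0.
Qed.

(** * Compatibility of the expansion with the brackets *)

Section Bracket.
Variables (eta : K) (D : nat -> {linear A -> A}).
Hypotheses (eta_neq0 : eta != 0) (Dskew : higher_skew_poisson_derivation eta alpha D).
Hypotheses (Diter : iterative D) (Dnil : locally_nilpotent D) (D1 : D 1%N =1 delta).

Local Notation u := (eta^-1 *: YL : L).

Lemma delta_higher i a : delta (D i a) = D i.+1 a *+ i.+1.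
Proof. by rewrite -D1 Diter add1n bin1. Qed.

Lemma pbrXu : {[XL, u]} = 0.
Proof. by rewrite pbrZr laurent_pbrXV laurent_pbrXX mulr0 oppr0 scaler0. Qed.

(** In characteristic 2 this needs more than skew-symmetry; it is derived from [{X, X} = 0]. *)
Lemma pbruu : {[u, u]} = 0.
Proof.
by rewrite pbrZr laurent_pbrXV pbrC pbrXu oppr0 mulr0 oppr0 scaler0.
Qed.

(** For [n = 1], the quotient rule gives [{a, X^-1} = alpha(a) X^-1 + delta(a) X^-2]; dividing by
    [eta] and using [X^-1 = eta u] leaves one factor [eta] on [delta]. The power rule does the
    rest. *)
Lemma pbrCu a n : {[CL a, u ^+ n]} =
  (CL (alpha a) * u ^+ n + CL (eta *: delta a) * u ^+ n.+1) *+ n.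
Proof.
have base : {[CL a, u]} = CL (alpha a) * u + CL (eta *: delta a) * u ^+ 2.
  rewrite pbrZr laurent_pbrXV pbrC laurent_pbrX mulrN opprK mulrDr.
  rewrite scalerDr; congr (_ + _).
    rewrite -scalerAr; congr (_ *: _).
    transitivity (CL (alpha a) * YL * (XL * YL)); first by ring.
    by rewrite laurentXVK mulr1.
  rewrite linearZ /= exprZn -scalerAl -scalerAr scalerA.
  by rewrite [eta * _]mulrC expr2 mulfVK // [YL ^+ 2 * _]mulrC.
elim: n => [|n IHn].
  by rewrite mulr0n (derivation1 (d := pbr (CL a))) // => b c; exact: pbrMr.
rewrite exprS pbrMr IHn base; move: (CL (alpha a)) (CL _) u => p q v.
by rewrite mulrSr !exprS; ring.
Qed.

(** The image under [F] of the relation [{Y, a} = alpha(a) Y]. Commuting [D_i] past [alpha] gives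
    [F(alpha(a)) = A(a) + eta E(a)], and since [eta u X = 1], the product [eta E(a) X] is the sum of
    the [delta(D_i a) u^i]. *)
Lemma pbr_expansionX a : {[XL, expansion eta D a]} = expansion eta D (alpha a) * XL.
Proof.
have [N aN] := Dnil a; have [_ _ Dalpha] := Dskew.
rewrite (expansionE eta aN) (@expansionE _ _ N); last first.
  by move=> i le_i; rewrite Dalpha aN // linear0 scaler0 mul0rn addr0.
have -> : \sum_(i < N) CL (D i (alpha a)) * u ^+ i
  = \sum_(i < N) CL (alpha (D i a)) * u ^+ i
    + eta *: \sum_(i < N) CL (D i a *+ i) * u ^+ i.
  rewrite scaler_sumr -big_split; apply: eq_bigr => i _ /=.
  by rewrite Dalpha linearD mulrDl scalerMnr linearZ scalerAl.
have -> : \sum_(i < N) CL (D i a *+ i) * u ^+ i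
  = \sum_(i < N) CL (delta (D i a)) * u ^+ i.+1.
  (* The index shift is free at both ends: the term at [N] vanishes by the bound, the term at 0 by
     its factor [i]. *)
  transitivity (\sum_(i < N.+1) CL (D i a *+ i) * u ^+ i).
    by rewrite big_ord_recr /= aN // mul0rn linear0 mul0r addr0.
  rewrite big_ord_recl linear0 mul0r add0r; apply: eq_bigr => i _.
  by rewrite delta_higher.
have uX : eta *: (u * XL) = 1.
  by rewrite -scalerAl scalerA mulfV // scale1r mulrC laurentXVK.
rewrite linear_sum mulrDl -scalerAl !mulr_suml scaler_sumr -big_split.
apply: eq_bigr => i _ /=; rewrite pbrMr laurent_pbrX.
rewrite pbr_expr_eq0 ?pbrXu // mulr0 addr0 mulrDl mulrAC; congr (_ + _).
have -> : CL (delta (D i a)) * u ^+ i.+1 * XL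
  = CL (delta (D i a)) * u ^+ i * (u * XL) by rewrite exprSr; ring.
by rewrite scalerAr uX mulr1.
Qed.

Lemma pbr_expansion a b :
  {[expansion eta D a, expansion eta D b]} = expansion eta D {[a, b]}.
Proof.
have [N [aN bN]] := common_bound Dnil a b; have [Dhigher Dpbr _] := Dskew.
pose t i j := CL ({[D i a, D j b]}
  + (alpha (D j a) * D i b - D i a * alpha (D j b)) *+ i) * u ^+ (i + j).
have t0 i j : (N <= i)%N || (N <= j)%N ->
    {[D i a, D j b]} + (alpha (D j a) * D i b - D i a * alpha (D j b)) *+ i = 0.
  by case/orP=> leN; rewrite !(aN _ leN, bN _ leN) ?linear0 ?pbr0l ?pbr0r
    !(mulr0, mul0r) subrr mul0rn addr0.
rewrite [RHS](@expansionE _ _ (N + N)); last first.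
  move=> n le_n; rewrite Dpbr big1 // => i _; apply: t0.
  by have := ltn_ord i; lia.
transitivity (\sum_(i < N) \sum_(j < N) t i j); last first.
  rewrite cauchy_sum => [|i j /t0 tE]; last by rewrite /t tE linear0 mul0r.
  apply: eq_bigr => n _; rewrite Dpbr linear_sum mulr_suml.
  by apply: eq_bigr => i _; rewrite /t subnKC // -ltnS.
pose E c := \sum_(i < N) CL (D i c *+ i) * u ^+ i.
pose al c := \sum_(i < N) CL (alpha (D i c)) * u ^+ i.
pose dl c := \sum_(i < N) CL (eta *: delta (D i c)) * u ^+ i.+1.
have dlE c : (forall i, (N <= i)%N -> D i c = 0) -> dl c = eta *: E c.
  move=> cN; transitivity (eta *: \sum_(i < N.+1) CL (D i c *+ i) * u ^+ i).
    rewrite big_ord_recl linear0 mul0r add0r scaler_sumr; apply: eq_bigr => i _.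
    by rewrite delta_higher linearZ scalerAl.
  by rewrite big_ord_recr /= cN // mul0rn linear0 mul0r addr0.
pose B := \sum_(i < N) \sum_(j < N) CL {[D i a, D j b]} * u ^+ (i + j).
(* The factor [E b] comes from the brackets [{D_i a, u^j}], which carry the weight [j]; [E a] comes
   symmetrically from [{u^i, D_j b}]. The brackets [{u^i, u^j}] vanish. *)
transitivity (B + (al a + dl a) * E b - E a * (al b + dl b)).
  rewrite (expansionE eta aN) (expansionE eta bN).
  rewrite pbrC linear_sum -sumrN /B /al /dl -!big_split /= !big_distrlr /=.
  rewrite -big_split -sumrB; apply: eq_bigr => i _ /=.
  rewrite -pbrC linear_sum -big_split -sumrB; apply: eq_bigr => j _ /=.
  rewrite pbrMl !pbrMr laurent_pbrC pbrCu [{[u ^+ i, CL _]}]pbrC pbrCu.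
  rewrite (pbr_expr_eq0 (v := u)); last first.
    by rewrite pbrC pbr_expr_eq0 ?oppr0 ?pbruu.
  rewrite !raddfMn exprD /=.
  move: (CL {[_, _]}) (CL (eta *: _)) (CL (eta *: _)) u => p q r v.
  by move: (CL _) (CL _) (CL _) (CL _) => a1 b1 a2 b2; rewrite !exprS; ring.
rewrite !dlE // mulrDl mulrDr -scalerAl -scalerAr.
(* [E b] is moved to the front because in [t] the weighted index [i] belongs to [b] in the term
   [alpha (D j a) * D i b]. *)
have -> : B + (al a * E b + eta *: (E a * E b)) - (E a * al b + eta *: (E a * E b))
  = B + E b * al a - E a * al b by move: (eta *: _) => z; ring.
rewrite /B /E /al !big_distrlr /= -big_split -sumrB; apply: eq_bigr => i _ /=.
rewrite -big_split -sumrB; apply: eq_bigr => j _ /=.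
rewrite /t !(raddfD, raddfMn, rmorphM, raddfB) /= exprD; ring.
Qed.

End Bracket.

End Laurent.

(** * Expansions for [eta] and [- eta] undo each other *)

Section Inverse.
Variables (K : fieldType) (A : poissonAlgType K).
Variables (alpha delta alpha' delta' : {linear A -> A}).
Variables (halpha : poisson_derivation alpha) (halpha' : poisson_derivation alpha').
Variable (hdelta : poisson_skew_derivation alpha delta).
Variable (hdelta' : poisson_skew_derivation alpha' delta').
Variables (eta : K) (D : nat -> {linear A -> A}).
Hypotheses (Dhigher : higher_derivation D) (Diter : iterative D).
Hypothesis Dnil : locally_nilpotent D.

Local Notation L := (ore_laurent halpha hdelta).
Local Notation L' := (ore_laurent halpha' hdelta').

(** Stated between two arbitrary Laurent algebras over [A], so that it serves both composites, the
    second one with [- eta] in place of [eta]. *)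
Lemma expansionK (G : {lrmorphism L -> L'}) :
  (forall a, G (laurentC halpha hdelta a) = expansion halpha' hdelta' (- eta) D a) ->
  G (laurentXV halpha hdelta) = laurentXV halpha' hdelta' ->
  forall a, G (expansion halpha hdelta eta D a) = laurentC halpha' hdelta' a.
Proof.
move=> GC GY a; have [m am] := Dnil a; pose N := m.+1.
have aN i : (N <= i)%N -> D i a = 0 by move/ltnW/am.
set u := eta^-1 *: laurentXV halpha' hdelta'.
pose t i j := laurentC halpha' hdelta' (D j (D i a)) * (- u) ^+ j * u ^+ i.
rewrite (expansionE _ _ _ aN) raddf_sum.
transitivity (\sum_(i < N) \sum_(j < N) t i j).
  apply: eq_bigr => i _ /=; rewrite rmorphM rmorphXn /= linearZ /= GY GC.
  rewrite (@expansionE _ _ _ _ _ _ _ _ N) => [|j le_j].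
    by rewrite mulr_suml invrN scaleNr.
  by rewrite Diter aN ?mul0rn // (leq_trans le_j) ?leq_addr.
rewrite cauchy_sum => [|i j leN]; last first.
  by rewrite /t Diter aN ?mul0rn ?linear0 ?mul0r //; lia.
(* The factor [0 ^+ n] is [(- 1 + 1) ^+ n]: the binomials from iterativity and the signs from [- u]
   form its expansion, and only [n = 0] survives. *)
transitivity (\sum_(n < N + N) laurentC halpha' hdelta' (D n a) * u ^+ n * 0 ^+ n).
  apply: eq_bigr => n _; rewrite -[X in _ * X ^+ n](addNr (1 : L')) exprDn mulr_sumr.
  apply: eq_bigr => i _; have le_in : (i <= n)%N by rewrite -ltnS.
  rewrite /t Diter subnK // bin_sub // raddfMn /= exprNn expr1n mulr1.
  have -> : u ^+ n = u ^+ (n - i) * u ^+ i by rewrite -exprD subnK.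
  by ring.
rewrite /N addSn big_ord_recl big1 => [|i _]; last by rewrite expr0n mulr0.
by rewrite Dhigher.1 !expr0 !mulr1 addr0.
Qed.

End Inverse.

(** Passes from the predicate to the bundled structure, for which the generic morphism lemmas are
    available. *)
Lemma algebra_morphism_lrmorphism (K : fieldType) (A B : comAlgType K) (f : A -> B) :
  algebra_morphism f -> exists g : {lrmorphism A -> B}, f = g.
Proof.
move=> [flin fmon].
by exists (HB.pack_for {lrmorphism A -> B} f (GRing.isLinear.Build K A B *:%R f flin)
  (GRing.isMonoidMorphism.Build A B f fmon)).
Qed.

(** * The isomorphism, its inverse and its uniqueness *)

Theorem theorem2p11 (K : fieldType) (A : poissonAlgType K)
    (alpha delta : {linear A -> A})
    (halpha : poisson_derivation alpha)
    (hdelta : poisson_skew_derivation alpha delta)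
    (eta : K) (D : nat -> {linear A -> A}) :
  eta != 0 ->
  higher_skew_poisson_derivation eta alpha D ->
  iterative D ->
  locally_nilpotent D ->
  D 1%N =1 delta ->
  let h0 := poisson_skew_derivation0 alpha in
  let AX := ore_laurent halpha hdelta in
  let AY := ore_laurent halpha h0 in
  let F (a : A) : AX := \sum_(i \in [set: nat]%classic)
    (eta ^- i *: (laurentC halpha hdelta (D i a)
                  * laurentXV halpha hdelta ^+ i)) in
  algebra_morphism F /\
  exists! Fhat : AY -> AX,
    [/\ poisson_isomorphism Fhat,
        forall a : A, Fhat (laurentC halpha h0 a) = F a
      & Fhat (laurentX halpha h0) = laurentX halpha hdelta].
Proof.
move=> eta_neq0 Dskew Diter Dnil D1 h0 AX AY.
have [Dhigher _ _] := Dskew.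
have Fmor := expansion_algebra_morphism halpha hdelta eta Dhigher Dnil.
have Gmor := expansion_algebra_morphism halpha h0 (- eta) Dhigher Dnil.
move=> F; split; first exact: Fmor.
have [f fE] := algebra_morphism_lrmorphism Fmor.
have [g gE] := algebra_morphism_lrmorphism Gmor.
have XVX := laurentXVK halpha hdelta; have YVY := laurentXVK halpha h0.
have [Fh FhE] := algebra_morphism_lrmorphism
  (laurent_lift_algebra_morphism halpha h0 f XVX).
have [Gh GhE] := algebra_morphism_lrmorphism
  (laurent_lift_algebra_morphism halpha hdelta g YVY).
have FhC a : Fh (laurentC halpha h0 a) = expansion halpha hdelta eta D a.
  by rewrite -FhE fE laurent_liftC.
have FhX : Fh (laurentX halpha h0) = laurentX halpha hdelta.
  by rewrite -FhE laurent_liftX.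
have GhC a : Gh (laurentC halpha hdelta a) = expansion halpha h0 (- eta) D a.
  by rewrite -GhE gE laurent_liftC.
have GhX : Gh (laurentX halpha hdelta) = laurentX halpha h0.
  by rewrite -GhE laurent_liftX.
have FhY : Fh (laurentXV halpha h0) = laurentXV halpha hdelta.
  by apply: laurent_morphismXV; [exact: rmorphism_monoidP | rewrite FhX].
have GhY : Gh (laurentXV halpha hdelta) = laurentXV halpha h0.
  by apply: laurent_morphismXV; [exact: rmorphism_monoidP | rewrite GhX].
have GFh : cancel Fh Gh.
  apply: (@laurent_morphism_eq _ _ _ _ _ h0 AY (Gh \o Fh) id) => /=.
  - exact: raddfD.
  - by [].
  - exact: rmorphism_monoidP.
  - by [].
  - by move=> a; rewrite FhC expansionK.
  - by rewrite FhX GhX.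
have FGh : cancel Gh Fh.
  apply: (@laurent_morphism_eq _ _ _ _ _ hdelta AX (Fh \o Gh) id) => /=.
  - exact: raddfD.
  - by [].
  - exact: rmorphism_monoidP.
  - by [].
  - by move=> a; rewrite GhC expansionK // => b; rewrite FhC opprK.
  - by rewrite GhX FhX.
exists Fh; split; first split=> //.
  split; last by exists Gh.
  apply: laurent_poisson_morphism.
  - by rewrite -FhE; exact: laurent_lift_algebra_morphism.
  - by move=> a b; rewrite !FhC -pbr_expansion.
  (* In the source the skew derivation is zero, so only [alpha(a) Y] remains. *)
  - move=> a; have -> : {[laurentX halpha h0, laurentC halpha h0 a]}
        = laurentC halpha h0 (alpha a) * laurentX halpha h0.
      by rewrite laurent_pbrX linear0 addr0.
    by rewrite rmorphM /= !FhC FhX pbr_expansionX.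
  - by rewrite FhX laurent_pbrXX.
(* Uniqueness: a competitor agrees with [Fh] on [A] and at [Y], which forces its value at [Y^-1]. *)
move=> H [[[Hmor _] _] HC HX]; apply/funext/laurent_morphism_eq.
- exact: raddfD.
- by have [h ->] := algebra_morphism_lrmorphism Hmor; exact: raddfD.
- exact: rmorphism_monoidP.
- exact: Hmor.2.
- by move=> a; rewrite FhC HC.
- by rewrite FhX HX.
Qed.
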